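(* Let $A\in\mathbb{C}^{n\times n}$ have rank $r$ and be given by a Hartwig–Spindelböck decomposition $$A=U\begin{bmatrix}\Sigma K&\Sigma L\\0&0\end{bmatrix}U^{*}.$$ If $X$ is an arbitrary but fixed minimal rank weak Drazin inverse of $A$, then the weak CMP inverse $A^{w,c,\dagger}=A^{\dagger}AXAA^{\dagger}$ satisfies $$A^{w,c,\dagger}=A^{\dagger}AXAA^{\dagger}=U\begin{bmatrix}K^{*}KZ&0\\L^{*}KZ&0\end{bmatrix}U^{*}$$ for some minimal rank weak Drazin inverse $Z$ of $\Sigma K$.
   Context: $A^{*}$ is the conjugate transpose and $A^{\dagger}$ the Moore–Penrose inverse of $A$. $A^{D}$ is the Drazin inverse of $A$: with $k=\operatorname{ind}(A)$ the smallest nonnegative integer such that $\operatorname{rank}(A^k)=\operatorname{rank}(A^{k+1})$, it is the unique $T$ with $TAT=T$, $AT=TA$, $A^{k+1}T=A^k$. A matrix $X\in\mathbb{C}^{n\times n}$ is a minimal rank weak Drazin inverse of $A\in\mathbb{C}^{n\times n}$ if $XA^{k+1}=A^{k}$ for some $k\in\mathbb{N}$ and $\operatorname{rank}(X)=\operatorname{rank}(A^{D})$. For a fixed such $X$, the weak CMP inverse of $A$ is $A^{w,c,\dagger}=A^{\dagger}AXAA^{\dagger}$. Hartwig–Spindelböck decomposition: every $A\in\mathbb{C}^{n\times n}$ of rank $r$ can be written as $A=U\begin{bmatrix}\Sigma K&\Sigma L\\0&0\end{bmatrix}U^{*}$, where $U\in\mathbb{C}^{n\times n}$ is unitary, $\Sigma=\operatorname{diag}(\sigma_1I_{r_1},\ldots,\sigma_tI_{r_t})$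 is the diagonal matrix of (nonzero) singular values of $A$, $\sigma_1>\sigma_2>\cdots>\sigma_t>0$, $r_1+\cdots+r_t=r$, and $K\in\mathbb{C}^{r\times r}$, $L\in\mathbb{C}^{r\times(n-r)}$ satisfy $KK^{*}+LL^{*}=I_r$. *)

(* Defs.v *)
From HB Require Import structures.
From mathcomp Require Import all_boot all_order all_algebra.
From mathcomp Require Import sesquilinear spectral.

Set Implicit Arguments.
Unset Strict Implicit.
Unset Printing Implicit Defensive.

Import Order.TTheory GRing.Theory Num.Theory.

Local Open Scope ring_scope.
Local Open Scope sesquilinear_scope.

Section MoorePenrose.
Variable C : numClosedFieldType.

Definition is_mpinv m n (A : 'M[C]_(m, n)) (X : 'M[C]_(n, m)) : bool :=
  [&& A *m X *m A == A, X *m A *m X == X,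
      (A *m X)^t* == A *m X & (X *m A)^t* == X *m A].

Lemma trmxC_mul m n p (A : 'M[C]_(m, n)) (B : 'M[C]_(n, p)) :
  (A *m B)^t* = B^t* *m A^t*.
Proof. by rewrite trmx_mul map_mxM. Qed.

Lemma mulmx_trmxC_eq0 n (u : 'rV[C]_n) : u *m u^t* = 0 -> u = 0.
Proof.
move/matrixP/(_ 0 0); rewrite !mxE => /eqP.
rewrite psumr_eq0 => [/allP u0|j _]; last by rewrite !mxE -normCK exprn_ge0.
apply/rowP => j; have := u0 j (mem_index_enum _).
by rewrite !mxE -normCK sqrf_eq0 normr_eq0 => /eqP.
Qed.

Lemma row_free_gram_unit m n (G : 'M[C]_(m, n)) :
  row_free G -> G *m G^t* \in unitmx.
Proof.
move=> Gfree; rewrite -row_free_unit -kermx_eq0; apply/rowV0P => v.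
move=> /sub_kermxP; rewrite mulmxA => vGG0.
apply: (row_free_inj Gfree); rewrite mul0mx; apply: mulmx_trmxC_eq0.
by rewrite trmxC_mul mulmxA vGG0 mul0mx.
Qed.

Lemma mpinv_exists m n (A : 'M[C]_(m, n)) : exists X, is_mpinv A X.
Proof.
have [r [F [G [AE GU FU]]]] : exists r (F : 'M[C]_(m, r)) (G : 'M[C]_(r, n)),
    [/\ A = F *m G, G *m G^t* \in unitmx & F^t* *m F \in unitmx].
  exists (\rank A), (col_base A), (row_base A); split.
  - by rewrite mulmx_base.
  - by apply: row_free_gram_unit; exact: row_base_free.
  - rewrite -{2}[col_base A]trmxCK; apply: row_free_gram_unit.
    by rewrite /row_free mxrank_map mxrank_tr (eqP (col_base_full A)).
have GV : G *m (G^t* *m invmx (G *m G^t*)) = 1%:M by rewrite mulmxA mulmxV.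
have FV : (invmx (F^t* *m F) *m F^t*) *m F = 1%:M by rewrite -mulmxA mulVmx.
have herm_inv p (B : 'M[C]_p) : B \in unitmx -> B^t* = B -> (invmx B)^t* = invmx B.
  by move=> _ BB; rewrite trmx_inv map_invmx BB.
have GH : (invmx (G *m G^t*))^t* = invmx (G *m G^t*).
  by apply: herm_inv => //; rewrite trmxC_mul trmxCK.
have FH : (invmx (F^t* *m F))^t* = invmx (F^t* *m F).
  by apply: herm_inv => //; rewrite trmxC_mul trmxCK.
set Gi := G^t* *m invmx (G *m G^t*) in GV.
set Fi := invmx (F^t* *m F) *m F^t* in FV.
have AX : A *m (Gi *m Fi) = F *m Fi.
  by rewrite AE -mulmxA [G *m _]mulmxA GV mul1mx.
have XA : Gi *m Fi *m A = Gi *m G.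
  by rewrite AE -mulmxA [Fi *m _]mulmxA FV mul1mx.
exists (Gi *m Fi); rewrite /is_mpinv AX XA; apply/and4P; split; apply/eqP.
- by rewrite {1 2}AE -mulmxA [Fi *m _]mulmxA FV mul1mx.
- by rewrite -mulmxA [G *m _]mulmxA GV mul1mx.
- by rewrite !trmxC_mul trmxCK FH mulmxA.
- by rewrite !trmxC_mul trmxCK GH mulmxA.
Qed.

Definition mpinv m n (A : 'M[C]_(m, n)) : 'M[C]_(n, m) := xchoose (mpinv_exists A).

Lemma mpinvP m n (A : 'M[C]_(m, n)) : is_mpinv A (mpinv A).
Proof. exact: xchooseP. Qed.

Lemma mpinv_unique m n (A : 'M[C]_(m, n)) X : is_mpinv A X -> X = mpinv A.
Proof.
have := mpinvP A; move: (mpinv A) => Y.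
move=> /and4P[/eqP Y1 /eqP Y2 /eqP Y3 /eqP Y4].
move=> /and4P[/eqP X1 /eqP X2 /eqP X3 /eqP X4].
have AXY : A *m X = A *m Y.
  by rewrite -X3 -{1}Y1 -mulmxA trmxC_mul X3 Y3 mulmxA X1.
have XAY : X *m A = Y *m A.
  by rewrite -X4 -{1}Y1 -mulmxA mulmxA trmxC_mul Y4 X4 -mulmxA [A *m (X *m A)]mulmxA X1.
by rewrite -X2 XAY -mulmxA AXY mulmxA.
Qed.

End MoorePenrose.

Section Drazin.
Variable F : fieldType.

Lemma ind_exists n (A : 'M[F]_n) : exists k, \rank (A ^+ k) == \rank (A ^+ k.+1).
Proof.
have noninc k : (\rank (A ^+ k.+1) <= \rank (A ^+ k))%N.
  by rewrite exprS; exact: mxrankM_maxr.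
have [/existsP[k ?]|/existsPn neq] :=
  boolP [exists k : 'I_n.+1, \rank (A ^+ k) == \rank (A ^+ k.+1)].
  by exists k.
have dec k : (k <= n.+1)%N -> (\rank (A ^+ k) + k <= n)%N.
  elim: k => [|k IH] kn; first by rewrite addn0 rank_leq_row.
  apply: leq_trans (IH (ltnW kn)).
  by rewrite addnS -addSn leq_add2r ltn_neqAle noninc eq_sym (neq (Ordinal kn)).
by have := dec n.+1 (leqnn _); rewrite addnS ltnNge leq_addl.
Qed.

Definition ind n (A : 'M[F]_n) : nat := ex_minn (ind_exists A).

Definition is_drazin n (A T : 'M[F]_n) : bool :=
  [&& T *m A *m T == T, A *m T == T *m A & A ^+ (ind A).+1 *m T == A ^+ ind A].

Lemma drazin_exists n (A : 'M[F]_n) : exists T, is_drazin A T.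
Proof.
rewrite /is_drazin /ind; case: ex_minnP => k /eqP rk _.
have [W AW] : exists W, A ^+ k = W * A ^+ k.+1.
  apply/submxP; have sub : (A ^+ k.+1 <= A ^+ k)%MS by rewrite exprS submxMl.
  by rewrite -(geq_leqif (mxrank_leqif_sup sub)) rk.
have [Y AY] : exists Y, A ^+ k = A ^+ k.+1 * Y.
  have sub : ((A ^+ k.+1)^T <= (A ^+ k)^T)%MS by rewrite exprSr trmx_mul submxMl.
  have /submxP[Y YE] : ((A ^+ k)^T <= (A ^+ k.+1)^T)%MS.
    by rewrite -(geq_leqif (mxrank_leqif_sup sub)) !mxrank_tr rk.
  by exists Y^T; apply: trmx_inj; rewrite -mulmxE trmx_mul trmxK.
have AYj j i : A ^+ (k + i + j) * Y ^+ j = A ^+ (k + i).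
  elim: j i => [|j IH] i; first by rewrite addn0 mulr1.
  rewrite exprS mulrA (_ : (k + i + j.+1 = i + j + k.+1)%N); last first.
    by rewrite !addnS [(k + i)%N]addnC -addnA [(k + j)%N]addnC addnA.
  rewrite exprD -[_ * Y]mulrA -AY -exprD -(IH i).
  by rewrite [(k + i)%N]addnC addnAC.
have AWj j i : W ^+ j * A ^+ (k + i + j) = A ^+ (k + i).
  elim: j i => [|j IH] i; first by rewrite addn0 mul1r.
  rewrite exprSr -mulrA (_ : (k + i + j.+1 = k.+1 + (i + j))%N); last first.
    by rewrite addnS addSn addnA.
  by rewrite exprD [W * (_ * _)]mulrA -AW -exprD addnA IH.
have TE : W ^+ k.+1 * A ^+ k = A ^+ k * Y ^+ k.+1.
  have := AYj k.+1 0%N; have := AWj k.+1 0%N; rewrite !addn0 => hW hY.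
  by rewrite -{1}hY mulrA hW.
have ATE : A * (A ^+ k * Y ^+ k.+1) = A ^+ k * Y ^+ k.
  by rewrite exprS !mulrA -exprS -AY.
have TAE : W ^+ k.+1 * A ^+ k * A = W ^+ k * A ^+ k.
  by rewrite -mulrA -exprSr exprSr -mulrA -AW.
have WY : W ^+ k * A ^+ k = A ^+ k * Y ^+ k.
  have := AYj k 0%N; have := AWj k 0%N; rewrite !addn0 => hW hY.
  by rewrite -{1}hY mulrA hW.
exists (A ^+ k * Y ^+ k.+1); rewrite !mulmxE; apply/and3P; split; apply/eqP.
- have := AWj k.+1 0%N; rewrite addn0 => hW.
  by rewrite -{1}TE -!mulrA [A * _]mulrA -exprS
             [A ^+ k * (A ^+ _ * _)]mulrA -exprD mulrA hW.
- by rewrite ATE -TE TAE WY.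
- have := AYj k.+1 0%N; rewrite addn0 => hY.
  by rewrite mulrA -exprD addnC hY.
Qed.

Definition drazin n (A : 'M[F]_n) : 'M[F]_n := xchoose (drazin_exists A).

Lemma drazinP n (A : 'M[F]_n) : is_drazin A (drazin A).
Proof. exact: xchooseP. Qed.

Lemma drazin_unique n (A T : 'M[F]_n) : is_drazin A T -> T = drazin A.
Proof.
have := drazinP A; move: (drazin A) => S; rewrite /is_drazin !mulmxE.
move: (ind A) => k /and3P[/eqP S1 /eqP S2 /eqP S3] /and3P[/eqP T1 /eqP T2 /eqP T3].
have idem (X : 'M[F]_n) : X * A * X = X -> A * X = X * A ->
    forall j, X ^+ j.+1 * A ^+ j = X.
  move=> X1 X2; elim=> [|j IH]; first by rewrite mulr1.
  rewrite exprS [A ^+ _]exprS -mulrA [X ^+ _ * _]mulrA.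
  have -> : X ^+ j.+1 * A = A * X ^+ j.+1 by apply/esym; exact: commrX.
  by rewrite -[A * _ * _]mulrA IH mulrA.
have idT := idem T T1 T2 k; have idS := idem S S1 S2 k.
have TTAS : T = T * A * S by rewrite -[LHS]idT -S3 [A ^+ _]exprSr !mulrA idT.
have SA : A ^+ k * S ^+ k.+1 = S.
  rewrite -[RHS]idS; apply: commrX; apply/esym; apply: commrX; exact/esym.
have SAT : S = T * A * S.
  have TA : A ^+ k.+1 * T = T * A ^+ k.+1 by apply/esym/commrX/esym.
  by rewrite -[LHS]SA -T3 TA [A ^+ _]exprS -!mulrA SA mulrA.
by rewrite TTAS -SAT.
Qed.

Definition min_rank_weak_drazin n (A X : 'M[F]_n) : Prop :=
  (exists k, X *m A ^+ k.+1 = A ^+ k) /\ \rank X = \rank (drazin A).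

End Drazin.

Section HartwigSpindelbock.
Variable C : numClosedFieldType.

Definition weak_cmp n (A X : 'M[C]_n) : 'M[C]_n :=
  mpinv A *m A *m X *m A *m mpinv A.

Definition singular_value m n (A : 'M[C]_(m, n)) (s : C) : bool :=
  (0 <= s) && eigenvalue (A^t* *m A) (s ^+ 2).

Definition singular_mult m n (A : 'M[C]_(m, n)) (s : C) : nat :=
  \rank (eigenspace (A^t* *m A) (s ^+ 2)).

(* The cast along the sum of the multiplicities is needed because \mxdiag has  *)
(* size \sum_i rs i, which is only propositionally equal to r.                 *)
Definition singular_value_mx m n r (A : 'M[C]_(m, n)) (Sigma : 'M[C]_r) : Prop :=
  exists (t : nat) (rs : 'I_t -> nat) (sigma : 'I_t -> C)
         (def_r : (\sum_(i < t) rs i)%N = r),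
    [/\ forall i, (0 < rs i)%N /\ 0 < sigma i,
        forall i j : 'I_t, (i < j)%N -> sigma j < sigma i,
        forall s, 0 < s -> singular_value A s <-> exists i, s = sigma i,
        forall i, singular_mult A (sigma i) = rs i
      & Sigma = castmx (def_r, def_r) (\mxdiag_(i < t) (sigma i)%:M)].

Definition hartwig_spindelbock r m (A U : 'M[C]_(r + m))
    (Sigma K : 'M[C]_r) (L : 'M[C]_(r, m)) : Prop :=
  [/\ U \is unitarymx, singular_value_mx A Sigma,
      K *m K^t* + L *m L^t* = 1%:M
    & A = U *m block_mx (Sigma *m K) (Sigma *m L) 0 0 *m U^t*].

End HartwigSpindelbock.

(* Main.v *)
Require Import Defs.
From HB Require Import structures.
From mathcomp Require Import all_boot all_order all_algebra.
From mathcomp Require Import sesquilinear spectral reals complex.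

(* Put P = U [I; 0], H = [K L] U^* and Q = Sigma H.  Then A = P Q and Q P =     *)
(* Sigma K, where P has orthonormal columns and H orthonormal rows, so that     *)
(* A^(k+1) = P (Sigma K)^k Q.  A weak Drazin inverse X has minimal rank iff     *)
(* X = A^k W for some k with X A^(k+1) = A^k; hence P P^* X = X, and            *)
(* Z := P^* X P is a minimal rank weak Drazin inverse of Sigma K.  Moreover     *)
(* A A^+ = P P^* and A^+ A = H^* H, so that                                     *)
(* A^+ A X A A^+ = H^* H X P P^* = H^* (H P) Z P^* = H^* K Z P^*.               *)

Set Implicit Arguments.
Unset Strict Implicit.
Unset Printing Implicit Defensive.

Import Order.TTheory GRing.Theory Num.Theory.

Local Open Scope ring_scope.
Local Open Scope sesquilinear_scope.

Section MinimalRankWeakDrazin.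
Variable F : fieldType.

(** The minimal rank condition is a range condition: together with X A^(k+1) = A^k it says that X
    and A^k have the same column space for large k. Such a condition passes from P Q to Q P when P
    and Q have one-sided inverses ([min_rank_weak_drazin_swap]), while orthonormality of P and H
    makes both projectors in the weak CMP inverse explicit ([weak_cmp_mul]). *)

(** Each matrix factors through the other: with T the Drazin inverse, T = A^j T^(j+1) and A^j =
    A^(j+1) T. *)
Lemma rank_drazin n (A : 'M[F]_n) j :
  (ind A <= j)%N -> \rank (drazin A) = \rank (A ^+ j).
Proof.
move=> lej; have := drazinP A; move: (drazin A) => T; rewrite /is_drazin !mulmxE.
move=> /and3P[/eqP T1 /eqP T2 /eqP T3].
have TA : A ^+ j = A ^+ j.+1 * T.
  by rewrite -(subnK lej) -addnS !exprD -mulrA T3.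
have idem i : T = A ^+ i * T ^+ i.+1.
  elim: i => [|i IH]; first by rewrite mul1r.
  by rewrite -[LHS]T1 -T2 [A ^+ i.+1]exprS [T ^+ i.+2]exprSr {1}IH !mulrA.
apply/eqP; rewrite eqn_leq; apply/andP; split.
  by rewrite {1}(idem j) -mulmxE; exact: mxrankM_maxl.
by rewrite TA -mulmxE; exact: mxrankM_maxr.
Qed.

Lemma weak_drazin_leq n (A X : 'M[F]_n) k j :
  (k <= j)%N -> X *m A ^+ k.+1 = A ^+ k -> X *m A ^+ j.+1 = A ^+ j.
Proof.
by move=> lekj XA; rewrite -(subnKC lekj) -addSn !exprD !mulmxE mulrA -mulmxE XA.
Qed.

(** The equation puts the column space of A^k inside that of X; once k >= ind A the ranks agree, so
    the two spaces coincide. *)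
Lemma min_rank_weak_drazin_range n (A X : 'M[F]_n) :
  min_rank_weak_drazin A X ->
  exists k0, forall k, (k0 <= k)%N ->
    X *m A ^+ k.+1 = A ^+ k /\ exists W, X = A ^+ k *m W.
Proof.
move=> [[l XA] rX]; exists (maxn l (ind A)) => k.
rewrite geq_max => /andP[lelk leik].
have XAk := weak_drazin_leq lelk XA; split=> //.
have sub : ((A ^+ k)^T <= X^T)%MS by rewrite -XAk trmx_mul submxMl.
have /submxP[W WE] : (X^T <= (A ^+ k)^T)%MS.
  by rewrite -(geq_leqif (mxrank_leqif_sup sub)) !mxrank_tr rX (rank_drazin leik).
by exists W^T; apply: trmx_inj; rewrite trmx_mul trmxK.
Qed.

Lemma range_min_rank_weak_drazin n (A X W : 'M[F]_n) k :
  X *m A ^+ k.+1 = A ^+ k -> X = A ^+ k *m W -> min_rank_weak_drazin A X.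
Proof.
move=> XA XE; split; first by exists k.
(* Since A^k = X A^(k+1), the rank has already stabilized at k. *)
have leik : (ind A <= k)%N.
  rewrite /ind; case: ex_minnP => i _; apply; rewrite eqn_leq.
  by rewrite -{1}XA mxrankM_maxr exprS -mulmxE mxrankM_maxr.
apply/eqP; rewrite (rank_drazin leik) eqn_leq.
by rewrite {1}XE mxrankM_maxl -{1}XA mxrankM_maxl.
Qed.

Lemma exprS_mulmx n r (P : 'M[F]_(n, r)) (Q : 'M[F]_(r, n)) k :
  (P *m Q) ^+ k.+1 = P *m (Q *m P) ^+ k *m Q.
Proof.
elim: k => [|k IH]; first by rewrite expr1 expr0 mulmx1.
by rewrite exprS IH [_ ^+ k.+1]exprS -!mulmxE !mulmxA.
Qed.

Lemma min_rank_weak_drazin_swap n r (P : 'M[F]_(n, r)) (Q : 'M[F]_(r, n))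
    (P' : 'M[F]_(r, n)) (Q' : 'M[F]_(n, r)) (X : 'M[F]_n) :
  P' *m P = 1%:M -> Q *m Q' = 1%:M -> min_rank_weak_drazin (P *m Q) X ->
  min_rank_weak_drazin (Q *m P) (P' *m X *m P) /\ P *m P' *m X = X.
Proof.
(* The exponent k+1 makes the power of P Q start with P and end with Q, so that [P'] and [Q'] can
   cancel them. *)
move=> PP QQ /min_rank_weak_drazin_range[k /(_ k.+1 (leqnSn k))].
rewrite !(exprS_mulmx P) => -[XA [W XE]]; split; last first.
  by rewrite XE !mulmxA -(mulmxA P P') PP mulmx1.
apply: (@range_min_rank_weak_drazin _ _ _ (Q *m W *m P) k).
  have := congr1 (fun M => P' *m M *m Q') XA.
  by rewrite !mulmxA PP mul1mx -!(mulmxA _ Q Q') QQ !mulmx1.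
by rewrite XE !mulmxA PP mul1mx.
Qed.

End MinimalRankWeakDrazin.

Lemma mpinv_mul (C : numClosedFieldType) n r (P : 'M[C]_(n, r)) (S : 'M[C]_r)
    (H : 'M[C]_(r, n)) :
  P^t* *m P = 1%:M -> S \in unitmx -> H *m H^t* = 1%:M ->
  mpinv (P *m (S *m H)) = H^t* *m invmx S *m P^t*.
Proof.
move=> PP Su HH; apply/esym/mpinv_unique.
have AY : P *m (S *m H) *m (H^t* *m invmx S *m P^t*) = P *m P^t*.
  by rewrite !mulmxA -(mulmxA _ H) HH mulmx1 -(mulmxA _ S) mulmxV // mulmx1.
have YA : H^t* *m invmx S *m P^t* *m (P *m (S *m H)) = H^t* *m H.
  by rewrite !mulmxA -(mulmxA _ _ P) PP mulmx1 -(mulmxA _ _ S) mulVmx // mulmx1.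
rewrite /is_mpinv AY YA; apply/and4P; split; apply/eqP.
- by rewrite !mulmxA -(mulmxA P) PP mulmx1.
- by rewrite !mulmxA -(mulmxA _ H) HH mulmx1.
- by rewrite trmxC_mul trmxCK.
- by rewrite trmxC_mul trmxCK.
Qed.

Lemma weak_cmp_mul (C : numClosedFieldType) n r (P : 'M[C]_(n, r))
    (S : 'M[C]_r) (H : 'M[C]_(r, n)) (X : 'M[C]_n) :
  P^t* *m P = 1%:M -> S \in unitmx -> H *m H^t* = 1%:M ->
  weak_cmp (P *m (S *m H)) X = H^t* *m H *m X *m P *m P^t*.
Proof.
move=> PP Su HH; rewrite /weak_cmp (mpinv_mul PP Su HH) !mulmxA.
rewrite -(mulmxA _ (P^t*) P) PP mulmx1 -(mulmxA _ (invmx S) S) mulVmx // mulmx1.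
by rewrite -(mulmxA _ H (H^t*)) HH mulmx1 -(mulmxA _ S) mulmxV // mulmx1.
Qed.

Theorem theorem2p1 (R : realType) (r m : nat) (A U : 'M[R[i]]_(r + m))
    (Sigma K : 'M[R[i]]_r) (L : 'M[R[i]]_(r, m)) (X : 'M[R[i]]_(r + m)) :
  \rank A = r ->
  hartwig_spindelbock A U Sigma K L ->
  min_rank_weak_drazin A X ->
  exists Z : 'M[R[i]]_r,
    min_rank_weak_drazin (Sigma *m K) Z /\
    weak_cmp A X = U *m block_mx (K^t* *m K *m Z) 0 (L^t* *m K *m Z) 0 *m U^t*.
Proof.
move=> rA [/unitarymxP UU _ KL AE] XA.
have U'U : U^t* *m U = 1%:M by apply: mulmx1C.
pose P := U *m col_mx 1%:M 0; pose H := row_mx K L *m U^t*.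
have PE : P^t* = row_mx 1%:M 0 *m U^t*.
  by rewrite trmxC_mul tr_col_mx map_row_mx trmx1 map_mx1 trmx0 map_mx0.
have HE : H^t* = U *m col_mx (K^t*) (L^t*).
  by rewrite trmxC_mul trmxCK tr_row_mx map_col_mx.
have PP : P^t* *m P = 1%:M.
  rewrite PE !mulmxA -(mulmxA _ _ U) U'U mulmx1 mul_row_col.
  by rewrite mulmx1 mulmx0 addr0.
have HH : H *m H^t* = 1%:M.
  by rewrite HE !mulmxA -(mulmxA _ _ U) U'U mulmx1 mul_row_col.
have HP : H *m P = K.
  rewrite !mulmxA -(mulmxA _ _ U) U'U mulmx1 mul_row_col.
  by rewrite mulmx1 mulmx0 addr0.
have AF : A = P *m (Sigma *m H).
  rewrite AE /P /H !mulmxA; congr (_ *m _); rewrite -!mulmxA; congr (_ *m _).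
  by rewrite mul_mx_row mul_col_row !mul1mx !mul0mx.
clearbody P H.
(* A factors through [Sigma], so r = rank A <= rank [Sigma]. *)
have Su : Sigma \in unitmx.
  rewrite -row_full_unit /row_full eqn_leq rank_leq_col -{1}rA AF.
  exact: leq_trans (mxrankM_maxr _ _) (mxrankM_maxl _ _).
have GG : (Sigma *m H) *m (H^t* *m invmx Sigma) = 1%:M.
  by rewrite !mulmxA -(mulmxA _ H) HH mulmx1 mulmxV.
rewrite AF in XA *.
have [ZB PX] := min_rank_weak_drazin_swap PP GG XA.
rewrite -(mulmxA Sigma) HP in ZB.
exists (P^t* *m X *m P); split=> //.
set Z := P^t* *m X *m P.
have -> : weak_cmp (P *m (Sigma *m H)) X = H^t* *m K *m Z *m P^t*.
  (* Inserting P P^* before X turns H X P into (H P)(P^* X P) = K Z. *)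
  by rewrite (weak_cmp_mul _ PP Su HH) -{1}PX -HP !mulmxA.
rewrite HE PE !mulmxA; congr (_ *m _); rewrite -!mulmxA; congr (_ *m _).
by rewrite block_mxEh !mul_mx_row mulmx1 !mulmx0 mul_col_mx col_mx0.
Qed.
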